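(* Let $n\ge1$, $r\ge 1$ and $\pi_1,\dots,\pi_r\in\mathfrak{B}_n$. An element $\sigma\in\mathfrak{B}_n$ is a maximal element below $\pi_1,\dots,\pi_r$ if and only if the four inequalities $$\ell_1(\sigma)\ge\max_{1\le j\le r}\ell_1(\pi_j),\quad \ell_2(\sigma)\le\min_{1\le j\le r}\ell_2(\pi_j),\quad \ell_3(\sigma)\le\min_{1\le j\le r}\ell_3(\pi_j),\quad \ell_4(\sigma)\ge\max_{1\le j\le r}\ell_4(\pi_j)$$ all hold, with equality in both the inequalities for $\ell_2$ and $\ell_3$, or with equality in both the inequalities for $\ell_1$ and $\ell_4$.
   Context: $\mathfrak{S}_n$ is the set of permutations of $[n]=\{1,\dots,n\}$, in one-line notation. A reduction of $\omega\in\mathfrak{S}_n$ interchanges $\omega(i)$ and $\omega(j)$ for some $i<j$ with $\omega(i)>\omega(j)$. Bruhat order: $\pi\le\sigma$ if $\pi$ is obtained from $\sigma$ by a (possibly empty) sequence of reductions. $\mathfrak{B}_n\subseteq\mathfrak{S}_n$ is the set of bigrassmannian permutations (both $\omega$ and $\omega^{-1}$ have exactly one descent), with the order inherited from Bruhat order; equivalently $\omega=1\cdots a\,(b+1)\cdots c\,(a+1)\cdots b\,(c+1)\cdots n$ for a unique triple $0\le a<b<c\le n$. The length vector of such an element is $(\ell_1,\ell_2,\ell_3,\ell_4)=(a+1,b-a,c-b,n+1-c)$. $\sigma\in\mathfrak{B}_n$ is a maximal element below $\pi_1,\dots,\pi_r$ if $\sigma\le\pi_i$ for each $i$, and whenever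 $\tau\in\mathfrak{B}_n$ satisfies $\tau\le\pi_i$ for all $i$ and $\tau\ge\sigma$, then $\tau=\sigma$. *)

(* Defs.v *)
From mathcomp Require Import all_boot all_fingroup zify.

Set Implicit Arguments.
Unset Strict Implicit.
Unset Printing Implicit Defensive.

(* [n] is represented by 'I_n, so positions and values are shifted by one. *)

(* Products of permutations act from left to right, so [tperm i j * w] is [w]
   with its values at the positions [i] and [j] interchanged. *)
Definition reduction (n : nat) : rel 'S_n := fun w v =>
  [exists i : 'I_n, exists j : 'I_n,
     [&& i < j, w j < w i & v == (tperm i j * w)%g]].

Definition bruhat_le (n : nat) (p s : 'S_n) : bool := connect (@reduction n) s p.

Definition descents (n : nat) (w : 'S_n) : {set 'I_n} :=
  [set i : 'I_n | [exists j : 'I_n, (j == i.+1 :> nat) && (w j < w i)]].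

Definition bigrassmannian (n : nat) (w : 'S_n) : bool :=
  (#|descents w| == 1) && (#|descents w^-1%g| == 1).

Definition one_line (n : nat) (w : 'S_n) : seq nat :=
  [seq (w i).+1 | i <- enum 'I_n].

(* 1 ... a (b+1) ... c (a+1) ... b (c+1) ... n *)
Definition block_word (n a b c : nat) : seq nat :=
  iota 1 a ++ iota b.+1 (c - b) ++ iota a.+1 (b - a) ++ iota c.+1 (n - c).

Definition is_triple (n : nat) (w : 'S_n) (a b c : nat) : bool :=
  [&& a < b, b < c, c <= n & one_line w == block_word n a b c].

(* The triple (a, b, c) of [w], which is unique by [tripleE]; the default value
   is only used when [w] is not bigrassmannian. *)
Definition triple (n : nat) (w : 'S_n) : nat * nat * nat :=
  if [pick t : 'I_n.+1 * 'I_n.+1 * 'I_n.+1 | is_triple w t.1.1 t.1.2 t.2]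
    is Some t then (t.1.1 : nat, t.1.2 : nat, t.2 : nat) else (0, 0, 0).

Definition ell1 (n : nat) (w : 'S_n) : nat := let: (a, _, _) := triple w in a + 1.
Definition ell2 (n : nat) (w : 'S_n) : nat := let: (a, b, _) := triple w in b - a.
Definition ell3 (n : nat) (w : 'S_n) : nat := let: (_, b, c) := triple w in c - b.
Definition ell4 (n : nat) (w : 'S_n) : nat := let: (_, _, c) := triple w in n + 1 - c.

Definition maximal_below (n r : nat) (p : 'I_r -> 'S_n) (s : 'S_n) : Prop :=
  [/\ bigrassmannian s,
      forall j : 'I_r, bruhat_le s (p j)
    & forall t : 'S_n, bigrassmannian t ->
        (forall j : 'I_r, bruhat_le t (p j)) -> bruhat_le s t -> t = s].

Lemma nth_block_word (n a b c i : nat) : a < b -> b < c -> c <= n -> i < n ->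
  nth 0 (block_word n a b c) i =
    if i < a then i.+1 else if i < a + (c - b) then i - a + b.+1
    else if i < c then i - (c - b) + 1 else i.+1.
Proof.
move=> ab bc cn lt_in; rewrite /block_word !nth_cat !size_iota.
case: ifP => h1; first by rewrite nth_iota; lia.
case: ifP => h2; first by rewrite nth_iota ?ifT; lia.
by case: ifP => h3; rewrite nth_iota; do ?case: ifP; lia.
Qed.

Lemma block_word_inj (n a b c a' b' c' : nat) :
  a < b -> b < c -> c <= n -> a' < b' -> b' < c' -> c' <= n ->
  block_word n a b c = block_word n a' b' c' -> (a, b, c) = (a', b', c').
Proof.
move=> ab bc cn ab' bc' cn' E.
have F i : i < n -> _ := fun lt_in => etrans (esym (nth_block_word ab bc cn lt_in))
  (etrans (congr1 (fun s => nth 0 s i) E) (nth_block_word ab' bc' cn' lt_in)).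
have Ea : a = a'.
  have := F (minn a a'); do !case: ifP; lia.
have Eb : b = b'.
  have := F a; do !case: ifP; lia.
have Ec : c = c'.
  have := F (a + (minn c c' - b)); do !case: ifP; lia.
by rewrite Ea Eb Ec.
Qed.

Lemma tripleE (n : nat) (w : 'S_n) (a b c : nat) :
  is_triple w a b c -> triple w = (a, b, c).
Proof.
move=> abc; rewrite /triple; case: pickP => [[[x y] z] /= | /=].
  case/and4P: abc => ab bc cn /eqP E /and4P[xy yz zn /eqP E'].
  by apply: (@block_word_inj n); rewrite // -E -E'.
case/and4P: (abc) => ab bc cn _.
have Hc : c < n.+1 by lia.
have Hb : b < n.+1 by lia.
have Ha : a < n.+1 by lia.
by move/(_ (Ordinal Ha, Ordinal Hb, Ordinal Hc)); rewrite /= abc.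
Qed.

(* Main.v *)
(* For bigrassmannian permutations, v <= w in Bruhat order iff
   ell1 v >= ell1 w, ell2 v <= ell2 w, ell3 v <= ell3 w and ell4 v >= ell4 w.
   A reduction does not increase the number of positions below x carrying a
   value at least y; for v this number is ell3 v at the inner corner of its two
   exchanged blocks, and comparing it with the number for w gives the four
   inequalities. Conversely, one descends from w to v by steps that lower ell2
   or ell3 by one and raise ell1 or ell4 by one, each of which moves a single
   letter across a block, in w or in its inverse. Since the four lengths sum to
   n + 2, a common lower bound fails to be maximal exactly when one of the two
   middle lengths can be raised while one of the two outer ones is lowered. *)

Require Import Defs.
From mathcomp Require Import all_boot all_fingroup zify.

Set Implicit Arguments.
Unset Strict Implicit.
Unset Printing Implicit Defensive.

(** * Block permutations with positions and values counted from 0 *)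

Definition block_fun (a b c i : nat) : nat :=
  if i < a then i else if i < a + (c - b) then i - a + b
  else if i < c then i - (c - b) else i.

Lemma is_tripleP (n : nat) (w : 'S_n) (a b c : nat) :
  reflect [/\ a < b, b < c, c <= n & forall i : 'I_n, w i = block_fun a b c i :> nat]
    (is_triple w a b c).
Proof.
have size_one : size (one_line w) = n by rewrite size_map size_enum_ord.
have nth_one (i : 'I_n) : nth 0 (one_line w) i = (w i).+1.
  by rewrite (nth_map i) ?size_enum_ord // nth_ord_enum.
apply: (iffP and4P) => [[ab bc cn /eqP E] | [ab bc cn E]]; split => //.
  move=> i; have := nth_one i; rewrite E nth_block_word // /block_fun.
  by do !case: ifP; lia.
apply/eqP/(@eq_from_nth _ 0) => [|k].
  by rewrite size_one !size_cat !size_iota; lia.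
rewrite size_one => kn; rewrite (nth_one (Ordinal kn)) E nth_block_word // /block_fun /=.
by do !case: ifP; lia.
Qed.

Lemma is_triple_inj (n : nat) (w v : 'S_n) (a b c : nat) :
  is_triple w a b c -> is_triple v a b c -> w = v.
Proof.
case/is_tripleP=> _ _ _ Ew /is_tripleP[_ _ _ Ev].
by apply/permP => i; apply/val_inj; rewrite /= Ew Ev.
Qed.

(** Inversion swaps the lengths of the two middle blocks, so a step that shrinks one of them yields
    a step that shrinks the other. *)
Lemma is_tripleV (n : nat) (w : 'S_n) (a b c : nat) :
  is_triple w a b c -> is_triple w^-1%g a (a + (c - b)) c.
Proof.
case/is_tripleP=> ab bc cn E; apply/is_tripleP; split=> [|||i]; try lia.
rewrite -{2}(permKV w i) E; set k := (w^-1)%g i; have := ltn_ord k.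
by rewrite /block_fun; do !case: ifP; lia.
Qed.

Lemma is_triple_ex (n a b c : nat) :
  a < b -> b < c -> c <= n -> exists w : 'S_n, is_triple w a b c.
Proof.
move=> ab bc cn.
have H (i : 'I_n) : block_fun a b c i < n.
  by have := ltn_ord i; rewrite /block_fun; do !case: ifP; lia.
have inj : injective (fun i => Ordinal (H i)).
  move=> i j /(congr1 val) /=; rewrite /block_fun => E; apply/val_inj => /=.
  by move: E; do !case: ifP; lia.
by exists (perm inj); apply/is_tripleP; split=> // i; rewrite permE.
Qed.

Lemma card_descents_triple (n : nat) (w : 'S_n) (a b c : nat) :
  is_triple w a b c -> #|descents w| = 1.
Proof.
case/is_tripleP=> ab bc cn E.
have lt_n : (a + (c - b)).-1 < n by lia.
have lt_n' : a + (c - b) < n by lia.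
apply/eqP/cards1P; exists (Ordinal lt_n); apply/setP => i; rewrite !inE.
apply/existsP/eqP => [[j /andP[/eqP ji]] | ->].
  rewrite !E ji /block_fun => H; apply/val_inj => /=.
  by move: H (ltn_ord j); rewrite ji; do !case: ifP; lia.
exists (Ordinal lt_n'); rewrite !E /= /block_fun.
by apply/andP; split; [apply/eqP; lia | do !case: ifP; lia].
Qed.

Lemma is_triple_bigrassmannian (n : nat) (w : 'S_n) (a b c : nat) :
  is_triple w a b c -> bigrassmannian w.
Proof.
move=> T; rewrite /bigrassmannian (card_descents_triple T).
by rewrite (card_descents_triple (is_tripleV T)).
Qed.

(** * Existence of the triple *)

(** Consecutive values rise away from the descent; chaining these rises shows that [w] increases on
    [[0, m]] and on [[m + 1, n)]. *)
Lemma single_descent (n : nat) (w : 'S_n) : #|descents w| = 1 ->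
  exists m, [/\ m.+1 < n,
    forall i j : 'I_n, i = m :> nat -> j = m.+1 :> nat -> w j < w i
    & forall i j : 'I_n, i < j -> (j <= m) || (m < i) -> w i < w j].
Proof.
move/eqP/cards1P => [m Em].
have D (i j : 'I_n) : j = i.+1 :> nat -> (w j < w i) = (i == m).
  move=> ji; move/setP/(_ i): Em; rewrite !inE => <-.
  apply/idP/existsP => [lt|[k /andP[/eqP ki lt]]]; first by exists j; rewrite ji eqxx.
  by have -> : j = k by apply/val_inj; rewrite /= ji ki.
exists m; split.
- have : m \in descents w by rewrite Em set11.
  by rewrite inE => /existsP[j /andP[/eqP<- _]]; apply: ltn_ord.
- by move=> i j im jm; rewrite D ?im //; apply/eqP/val_inj.
move=> i j; have [k] := ubnP (j - i); elim: k j => // k IH j lek ij H.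
have jn : j.-1 < n by have := ltn_ord j; lia.
pose j' := Ordinal jn.
have step : w j' < w j.
  have ne : w j' != w j by apply: contraTneq ij => /perm_inj/(congr1 val) /=; lia.
  have ne' : (w j' : nat) <> w j by move=> e; case/eqP: ne; apply/val_inj.
  have : (w j < w j') = false.
    by rewrite D /=; [apply/negbTE/negP => /eqP/(congr1 val) /=; lia | lia].
  by lia.
have [e|ne] := eqVneq (j' : nat) i.
  by rewrite (_ : i = j') //; apply/val_inj.
by apply: ltn_trans step; apply: IH => /=; move/eqP: ne => /=; lia.
Qed.

(** With [x = w k] this recovers a value as the number of positions carrying a smaller one. *)
Lemma sum_perm_lt (n : nat) (w : 'S_n) (x : nat) : x <= n -> \sum_(i < n) (w i < x) = x.
Proof.
move=> xn; rewrite (reindex_inj (@perm_inj _ w^-1%g)) /=.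
under eq_bigr do rewrite permKV.
rewrite -(big_mkord xpredT (fun i => (i < x) : nat)) (@big_cat_nat _ _ _ x) //=.
rewrite (eq_big_nat _ _ (F2 := fun=> 1)); last by move=> i /= ->.
rewrite sum_nat_const_nat subn0 muln1 big_nat big1 ?addn0 // => i /andP[le _].
by rewrite ltnNge le.
Qed.

Lemma sum_interval (n lo hi : nat) : \sum_(i < n) ((lo <= i) && (i < hi)) = minn n hi - lo.
Proof.
elim: n => [|n IH]; first by rewrite big_ord0; lia.
by rewrite big_ord_recr /= IH; lia.
Qed.

Lemma sum_below (n hi : nat) : \sum_(i < n) (i < hi) = minn n hi.
Proof. by rewrite -[RHS]subn0 -sum_interval. Qed.

Lemma initial_cutoff (P : pred nat) (l h : nat) : l <= h ->
  (forall i j, l <= i -> i < j -> j < h -> P j -> P i) ->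
  exists m, [/\ l <= m, m <= h & forall i, l <= i -> i < h -> P i = (i < m)].
Proof.
elim: h => [|h IH] lh closed; first by exists l; split=> // i; lia.
have [e|lh'] := eqVneq l h.+1; first by exists l; split; lia.
case: (boolP (P h)) => Ph.
  exists h.+1; split=> // i li ih; rewrite ih.
  by have [->//|ne] := eqVneq i h; apply: closed Ph; lia.
have [||m [lm mh Em]] := IH; first by lia.
  by move=> i j li ij jh; apply: closed; lia.
exists m; split=> // [|i li ih]; first lia.
have [->|ne] := eqVneq i h; last by apply: Em; lia.
by rewrite (negbTE Ph); lia.
Qed.

(* Let e - 1 be the descent of w and b - 1 that of its inverse. The set of
   positions carrying a value below b is an initial segment of [0, e) together
   with an initial segment of [e, n), and it determines w because w is
   increasing on this set and on its complement. *)
Lemma bigrassmannian_triple (n : nat) (w : 'S_n) :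
  bigrassmannian w -> exists a b c, is_triple w a b c.
Proof.
case/andP => /eqP/single_descent [m [mn _ up]] /eqP/single_descent [v [vn downV upV]].
pose e := m.+1; pose b := v.+1.
have en : e < n := mn.
have upE (i j : 'I_n) : i < j -> (j < e) || (e <= i) -> w i < w j.
  by move=> ij; rewrite ltnS; apply: up.
(* The inverse increases on the values below [b] and on those from [b] on, so [w] increases on the
   positions of either kind. *)
have posE (i j : 'I_n) : (w i < b) = (w j < b) -> (w i < w j) = (i < j).
  move=> E.
  have mono (k l : 'I_n) : (w k < b) = (w l < b) -> w k < w l -> k < l.
    by move=> E' lt; have := upV (w k) (w l) lt; rewrite !permK; apply; lia.
  apply/idP/idP => [|ij]; first exact: mono.
  rewrite ltnNge; apply/negP; rewrite leq_eqVlt => /orP[/eqP e1|lt].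
    by move/val_inj/perm_inj: e1 => e2; rewrite e2 ltnn in ij.
  by have := mono j i (esym E) lt; lia.
have bn : v < n by lia.
pose ib := (w^-1)%g (Ordinal vn); pose iv := (w^-1)%g (Ordinal bn).
have wb : w ib = b :> nat by rewrite permKV.
have wv : w iv = v :> nat by rewrite permKV.
have ivb : ib < iv by apply: downV.
(* The value [b] occurs before [b - 1], so the descent of [w] separates their positions. This will
   make both middle blocks nonempty. *)
have [ibe evi] : ib < e /\ e <= iv.
  have := upE ib iv ivb; rewrite wb wv /b => H.
  by split; apply/negP => H'; have : v.+1 < v; [apply: H | lia | apply: H | lia]; lia.
pose P i := [exists k : 'I_n, (k == i :> nat) && (w k < b)].
have PE (k : 'I_n) : P k = (w k < b).
  apply/existsP/idP => [[l /andP[/eqP/val_inj-> //]]|lt].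
  by exists k; rewrite eqxx.
have closed l h : h <= n -> (h <= e) || (e <= l) ->
    forall i j, l <= i -> i < j -> j < h -> P j -> P i.
  move=> hn le i j li ij jh.
  have jn : j < n by lia.
  have in' : i < n by lia.
  rewrite (PE (Ordinal jn)) (PE (Ordinal in')).
  by have := upE (Ordinal in') (Ordinal jn) ij; rewrite /=; lia.
have [||a [_ ae Ea]] := @initial_cutoff P 0 e; [by []| by apply: closed; lia|].
have [||c [ec cn Ec]] := @initial_cutoff P e n; [lia| by apply: closed; lia|].
have wE (i : 'I_n) : (w i < b) = (i < a) || (e <= i) && (i < c).
  rewrite -PE; case: (ltnP i e) => H; first by rewrite Ea //; lia.
  by rewrite Ec //; lia.
(* Both sides count the positions carrying a value below [b]. *)
have bE : b = a + (c - e).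
  have <- := sum_perm_lt w (ltnW vn : b <= n).
  rewrite (eq_bigr (fun i : 'I_n => (i < a) + ((e <= i) && (i < c)))).
    by rewrite big_split /= ?sum_below !sum_interval; lia.
  by move=> i _; rewrite wE; lia.
have aib : a <= ib by have := wE ib; rewrite wb; lia.
have civ : iv < c by have := wE iv; rewrite wv; lia.
exists a, b, c; apply/is_tripleP; split; try lia.
(* Count the values smaller than [w k]. If [w k < b], they sit at the positions before [k] with
   value below [b]; otherwise, at all positions with value below [b] and at the remaining positions
   before [k]. *)
move=> k; rewrite -[LHS](sum_perm_lt w (ltnW (ltn_ord (w k)))).
have := wE k; case: (boolP (w k < b)) => lt /esym Hk.
  rewrite (eq_bigr (fun i : 'I_n => (i < minn a k) + ((e <= i) && (i < minn c k)))).
    by rewrite big_split /= ?sum_below !sum_interval /block_fun; have := ltn_ord k; do !case: ifP; lia.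
  move=> i _; case: (boolP (w i < b)) => Hi.
    by rewrite posE ?Hi ?lt //; have := wE i; rewrite Hi; lia.
  by have := wE i; lia.
rewrite (eq_bigr (fun i : 'I_n => (i < a) + ((a <= i) && (i < minn e k))
   + ((e <= i) && (i < c)) + ((c <= i) && (i < k)))).
  by rewrite !big_split /= ?sum_below !sum_interval /block_fun; have := ltn_ord k; do !case: ifP; lia.
move=> i _; case: (boolP (w i < b)) => Hi; first by have := wE i; lia.
by rewrite posE ?(negbTE Hi) ?(negbTE lt) //; have := wE i; lia.
Qed.

(** * Rank counts and the necessary inequalities *)

(** A reduction of [w] at [i < j] is, after inversion, a reduction of the inverse at [w j < w i], by
    conjugating the transposition with [w]. *)
Lemma bruhat_leV (n : nat) (v w : 'S_n) : bruhat_le v w -> bruhat_le v^-1%g w^-1%g.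
Proof.
case/connectP => s; elim: s w => [|u s IH] w /=; first by move=> _ ->; apply: connect0.
case/andP => /existsP[i /existsP[j /and3P[ij wji /eqP Eu]]] path_s last_s.
apply: connect_trans (IH u path_s last_s); apply: connect1.
apply/existsP; exists (w j); apply/existsP; exists (w i).
rewrite wji !permK ij Eu invMg tpermV tpermC -tpermJ conjgE.
by rewrite -!mulgA mulgV mulg1 /=.
Qed.

Definition rank_count (n : nat) (w : 'S_n) (x y : nat) : nat :=
  \sum_(k < n) ((k < x) && (y <= w k)).

(** Only the terms at [i] and [j] change, and the larger value moves to the later position. *)
Lemma rank_count_reduction (n : nat) (w v : 'S_n) (x y : nat) :
  reduction w v -> rank_count v x y <= rank_count w x y.
Proof.
case/existsP => i /existsP[j /and3P[ij wji /eqP->]]; rewrite /rank_count.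
have ji : j != i by apply/eqP => e; rewrite e ltnn in ij.
rewrite (bigD1 i) //= (bigD1 j) //= [X in _ <= X](bigD1 i) //=.
rewrite [X in _ <= _ + X](bigD1 j) //= !permM tpermL tpermR !addnA.
rewrite (eq_bigr (fun k : 'I_n => (k < x) && (y <= w k) : nat)).
  by rewrite leq_add2r; lia.
by move=> k /andP[ki kj]; rewrite permM tpermD // eq_sym.
Qed.

Lemma rank_count_bruhat (n : nat) (v w : 'S_n) (x y : nat) :
  bruhat_le v w -> rank_count v x y <= rank_count w x y.
Proof.
case/connectP => s; elim: s w => [|u s IH] w /=; first by move=> _ ->.
by case/andP => /(rank_count_reduction x y) le_uw path_s /(IH u path_s)/leq_trans; apply.
Qed.

(** On each of the four increasing blocks the counted positions form an interval, which gives one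
    truncated difference per block. *)
Lemma rank_count_triple (n : nat) (w : 'S_n) (a b c x y : nat) :
  is_triple w a b c -> x <= n ->
  rank_count w x y = (minn a x - y) + (minn (a + (c - b)) x - maxn a (y + a - b))
    + (minn c x - maxn (a + (c - b)) (y + (c - b))) + (x - maxn c y).
Proof.
case/is_tripleP => ab bc cn E xn; rewrite /rank_count.
rewrite (eq_bigr (fun k : 'I_n => ((y <= k) && (k < minn a x))
  + ((maxn a (y + a - b) <= k) && (k < minn (a + (c - b)) x))
  + ((maxn (a + (c - b)) (y + (c - b)) <= k) && (k < minn c x))
  + ((maxn c y <= k) && (k < x)))).
  have minx t : minn n (minn t x) = minn t x by apply/minn_idPr; rewrite geq_min xn orbT.
  by rewrite !big_split /= !sum_interval !minx (minn_idPr xn).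
by move=> k _; rewrite E /block_fun !geq_max !leq_min; do !case: ifP; lia.
Qed.

(* The hypothesis is the inequality of rank counts at the corner (x, y) of the
   smaller element, with q' = ell3 the count for that element. *)
Lemma block_rank_bound (a p q a' p' q' : nat) :
  0 < p -> 0 < q -> 0 < p' -> 0 < q' ->
  let x := a' + q' in let y := a' + p' in
  q' <= (minn a x - y) + (minn (a + q) x - maxn a (y - p))
    + (minn (a + p + q) x - maxn (a + q) (y + q)) + (x - maxn (a + p + q) y) ->
  [/\ a <= a', p' <= p, q' <= q & a' + p' + q' <= a + p + q].
Proof.
move=> p0 q0 p0' q0' x y.
have [xE yx xy] : [/\ x + p' = y + q', y < x + p' & x < y + q'] by split; lia.
have yE : y = a' + p' by []; clearbody x y.
(* Inside the fixed initial block the count is only [x - y], which is less than [q']. *)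
have [xa|ax] := leqP x a; first by move=> H; exfalso; lia.
have [xaq|aqx] := leqP x (a + q); have [ayp|ypa] := leqP a (y - p);
  have [cy|yc] := leqP (a + p + q) y; have [xc|cx] := leqP x (a + p + q);
  have [ay|ya] := leqP a y; move=> H; by [exfalso; lia | split; lia].
Qed.

Lemma bruhat_le_triple (n : nat) (v w : 'S_n) (a b c a' b' c' : nat) :
  is_triple w a b c -> is_triple v a' b' c' -> bruhat_le v w ->
  [/\ a <= a', b' - a' <= b - a, c' - b' <= c - b & c' <= c].
Proof.
(* The corner is given by the end and the least value of the second block of [v]. *)
move=> Tw Tv /(rank_count_bruhat (a' + (c' - b')) b').
case/is_tripleP: (Tw) => ab bc cn _; case/is_tripleP: (Tv) => ab' bc' cn' _.
have xn : a' + (c' - b') <= n by lia.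
rewrite (rank_count_triple _ Tw xn) (rank_count_triple _ Tv xn) {Tw Tv xn cn cn'}.
rewrite minnn !addKn maxnn addKn.
(* Of the count for [v] only the summand of the second block, equal to [c' - b'], is kept. *)
move/(leq_trans (leq_trans (leq_addl _ _) (leq_trans (leq_addr _ _) (leq_addr _ _)))).
move: (b - a) (c - b) (b' - a') (c' - b') (subnKC (ltnW ab)) (subnKC (ltnW bc))
  (subnKC (ltnW ab')) (subnKC (ltnW bc')) => p q p' q' Eb Ec Eb' Ec'.
have [p0 q0 p0' q0'] : [/\ 0 < p, 0 < q, 0 < p' & 0 < q'] by split; lia.
rewrite -{}Ec -{}Ec' -{}Eb -{}Eb' [_ + p' + a](addnC _ a) subnDl.
exact: block_rank_bound.
Qed.

(** * Descending chains and sufficiency of the inequalities *)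

(** The letter at [j] travels left to [i] past larger letters; each adjacent swap on its way is a
    reduction. *)
Lemma bruhat_le_insert_left (n : nat) (v w : 'S_n) (i j : 'I_n) : i <= j ->
  (forall k : 'I_n, i <= k -> k < j -> w j < w k) ->
  v i = w j ->
  (forall k l : 'I_n, i <= k -> k < j -> l = k.+1 :> nat -> v l = w k) ->
  (forall k : 'I_n, (k < i) || (j < k) -> v k = w k) ->
  bruhat_le v w.
Proof.
have [d] := ubnP (j - i); elim: d w j => // d IH w j lt_d ij small vi shift same.
have [e|ne] := eqVneq i j.
  subst j; rewrite (_ : v = w); first exact: connect0.
  apply/permP => k; have [->//|ne] := eqVneq k i; apply: same.
  by move/eqP: ne => ne; have : (k : nat) <> i by [move=> /val_inj]; lia.
have {}ij : i < j by rewrite ltn_neqAle ij andbT.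
have jn : j.-1 < n by have := ltn_ord j; lia.
pose h := Ordinal jn; have hE : h = j.-1 :> nat by [].
have hj : h != j by apply/eqP => /(congr1 val) /=; lia.
have wD (k : 'I_n) : (k : nat) != h -> (k : nat) != j -> (tperm h j * w)%g k = w k.
  by move=> kh kj; rewrite permM tpermD // eq_sym.
apply: (@connect_trans _ _ (tperm h j * w)%g).
  apply: connect1; apply/existsP; exists h; apply/existsP; exists j.
  by rewrite eqxx andbT small; lia.
apply: (IH _ h); rewrite ?permM ?tpermL //; try lia.
- by move=> k ik kh; rewrite wD; try lia; apply: small; lia.
- by move=> k l ik kh lk; rewrite wD; try lia; apply: shift; lia.
move=> k H; have [kj|kj] := eqVneq (k : nat) j.
  by rewrite (val_inj kj) permM tpermR; apply: shift; lia.
by rewrite wD //; [apply: same|]; lia.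
Qed.

(** The mirror image: the letter at [i] travels right to [j] past smaller letters. *)
Lemma bruhat_le_insert_right (n : nat) (v w : 'S_n) (i j : 'I_n) : i <= j ->
  (forall k : 'I_n, i < k -> k <= j -> w k < w i) ->
  v j = w i ->
  (forall k l : 'I_n, i <= k -> k < j -> l = k.+1 :> nat -> v k = w l) ->
  (forall k : 'I_n, (k < i) || (j < k) -> v k = w k) ->
  bruhat_le v w.
Proof.
have [d] := ubnP (j - i); elim: d w i => // d IH w i lt_d ij small vj shift same.
have [e|ne] := eqVneq i j.
  subst j; rewrite (_ : v = w); first exact: connect0.
  apply/permP => k; have [->//|ne] := eqVneq k i; apply: same.
  by move/eqP: ne => ne; have : (k : nat) <> i by [move=> /val_inj]; lia.
have {}ij : i < j by rewrite ltn_neqAle ij andbT.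
have hn : i.+1 < n by have := ltn_ord j; lia.
pose h := Ordinal hn; have hE : h = i.+1 :> nat by [].
have wD (k : 'I_n) : (k : nat) != i -> (k : nat) != h -> (tperm i h * w)%g k = w k.
  by move=> ki kh; rewrite permM tpermD // eq_sym.
apply: (@connect_trans _ _ (tperm i h * w)%g).
  apply: connect1; apply/existsP; exists i; apply/existsP; exists h.
  by rewrite eqxx andbT small; lia.
apply: (IH _ h); rewrite ?permM ?tpermR //; try lia.
- by move=> k hk kj; rewrite wD; try lia; apply: small; lia.
- by move=> k l hk kj lk; rewrite wD; try lia; apply: shift; lia.
move=> k H; have [ki|ki] := eqVneq (k : nat) i.
  by rewrite (val_inj ki) permM tpermL; apply: shift; lia.
by rewrite wD //; [apply: same|]; lia.
Qed.

(** The least letter of the third block moves left across the second block and joins the fixed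
    prefix. *)
Lemma bruhat_le_triple_left (n : nat) (v w : 'S_n) (a b c : nat) :
  is_triple w a b c -> is_triple v a.+1 b c -> bruhat_le v w.
Proof.
case/is_tripleP => ab bc cn Ew /is_tripleP [ab' _ _ Ev].
have lt_i : a < n by lia.
have lt_j : a + (c - b) < n by lia.
apply: (@bruhat_le_insert_left _ _ _ (Ordinal lt_i) (Ordinal lt_j)) => /=; first lia.
- by move=> k; rewrite !Ew /block_fun /=; do !case: ifP; lia.
- by apply/val_inj; rewrite /= Ew Ev /block_fun /=; do !case: ifP; lia.
- move=> k l ak ka lk; apply/val_inj; rewrite /= Ew Ev lk /block_fun.
  by do !case: ifP; lia.
by move=> k H; apply/val_inj; rewrite /= Ew Ev /block_fun; do !case: ifP; lia.
Qed.

(** The greatest letter of the second block moves right across the third block and joins the fixed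
    suffix. *)
Lemma bruhat_le_triple_right (n : nat) (v w : 'S_n) (a b c : nat) :
  is_triple w a b c.+1 -> is_triple v a b c -> bruhat_le v w.
Proof.
case/is_tripleP => ab _ cn Ew /is_tripleP [_ bc _ Ev].
have lt_i : a + (c - b) < n by lia.
have lt_j : c < n by lia.
apply: (@bruhat_le_insert_right _ _ _ (Ordinal lt_i) (Ordinal lt_j)) => /=; first lia.
- by move=> k; rewrite !Ew /block_fun /=; do !case: ifP; lia.
- by apply/val_inj; rewrite /= Ew Ev /block_fun /=; do !case: ifP; lia.
- move=> k l ak ka lk; apply/val_inj; rewrite /= Ew Ev lk /block_fun.
  by do !case: ifP; lia.
by move=> k H; apply/val_inj; rewrite /= Ew Ev /block_fun; do !case: ifP; lia.
Qed.

(** Induction on the total growth still required of the two outer blocks. While some is required, a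
    middle length of [w] exceeds that of [v] and can give up a letter. *)
Lemma triple_bruhat_le (n : nat) (v w : 'S_n) (a b c a' b' c' : nat) :
  is_triple w a b c -> is_triple v a' b' c' ->
  a <= a' -> b' - a' <= b - a -> c' - b' <= c - b -> c' <= c -> bruhat_le v w.
Proof.
move=> Tw Tv; case/is_tripleP: (Tv) => ab' bc' _ _.
have [d] := ubnP ((a' - a) + (c - c')); elim: d w a b c Tw => // d IH w a b c Tw lt_d le1 le2 le3 le4.
case/is_tripleP: (Tw) => ab bc cn _.
have step u x y z : is_triple u x y z -> bruhat_le u w ->
    (a' - x) + (z - c') < (a' - a) + (c - c') -> x <= a' -> b' - a' <= y - x ->
    c' - b' <= z - y -> c' <= z -> bruhat_le v w.
  move=> Tu uw lt *; apply: connect_trans uw _; apply: IH Tu _ _ _ _ _ => //.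
  by apply: leq_trans lt _.
case: (ltngtP a a') => [lt_a | | Ea]; [|lia|].
  have [lt2|ge2] := ltnP (b' - a') (b - a).
    have [||//|u Tu] := @is_triple_ex n a.+1 b c; try lia.
    by apply: (step _ _ _ _ Tu (bruhat_le_triple_left Tw Tu)); lia.
  (* Here [b - a] is already minimal, so [b] rises along with [a] and [c - b] shrinks; this is the
     left step for the inverses. *)
  have [||//|u Tu] := @is_triple_ex n a.+1 b.+1 c; try lia.
  apply: (step _ _ _ _ Tu); try lia.
  rewrite -[u]invgK -[w]invgK; apply: bruhat_leV.
  apply: bruhat_le_triple_left (is_tripleV Tw) _.
  by have := is_tripleV Tu; rewrite (_ : a.+1 + _ = a + (c - b)); last lia.
case: (ltngtP c' c) => [lt_c | | Ec]; [|lia|]; last first.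
  have Eb : b = b' by lia.
  by subst; rewrite (is_triple_inj Tv Tw); apply: connect0.
case: c lt_c Tw {lt_d} le3 le4 bc cn step => // c lt_c Tw le3 le4 bc cn step.
have [lt3|ge3] := ltnP (c' - b') (c.+1 - b).
  have [||//|u Tu] := @is_triple_ex n a b c; try lia.
  by apply: (step _ _ _ _ Tu (bruhat_le_triple_right Tw Tu)); lia.
(* Likewise, [b] falls along with the right end to keep the third length; this is the right step for
   the inverses. *)
have [||//|u Tu] := @is_triple_ex n a b.-1 c; try lia.
apply: (step _ _ _ _ Tu); try lia.
rewrite -[u]invgK -[w]invgK; apply: bruhat_leV.
apply: bruhat_le_triple_right (is_tripleV Tw) _.
by have := is_tripleV Tu; rewrite (_ : a + _ = a + (c.+1 - b)); last lia.
Qed.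

(** * Length vectors and maximal lower bounds *)

Lemma ell_triple (n : nat) (w : 'S_n) (a b c : nat) : is_triple w a b c ->
  [/\ ell1 w = a + 1, ell2 w = b - a, ell3 w = c - b & ell4 w = n + 1 - c].
Proof. by rewrite /ell1 /ell2 /ell3 /ell4 => /tripleE->. Qed.

Lemma ell_sum (n : nat) (w : 'S_n) : bigrassmannian w ->
  [/\ 0 < ell1 w, 0 < ell2 w, 0 < ell3 w, 0 < ell4 w
    & ell1 w + ell2 w + ell3 w + ell4 w = n + 2].
Proof.
case/bigrassmannian_triple => a [b [c T]]; case: (ell_triple T) => -> -> -> ->.
by case/is_tripleP: T => ab bc cn _; split; lia.
Qed.

Lemma ell_ex (n l1 l2 l3 l4 : nat) : 0 < l1 -> 0 < l2 -> 0 < l3 -> 0 < l4 ->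
  l1 + l2 + l3 + l4 = n + 2 -> exists w : 'S_n,
    bigrassmannian w /\ [/\ ell1 w = l1, ell2 w = l2, ell3 w = l3 & ell4 w = l4].
Proof.
move=> *; have [|||w T] := @is_triple_ex n l1.-1 (l1.-1 + l2) (l1.-1 + l2 + l3); try lia.
exists w; split; first exact: is_triple_bigrassmannian T.
by case: (ell_triple T) => -> -> -> ->; split; lia.
Qed.

Lemma bruhat_le_ell (n : nat) (v w : 'S_n) : bigrassmannian v -> bigrassmannian w ->
  bruhat_le v w =
    [&& ell1 w <= ell1 v, ell2 v <= ell2 w, ell3 v <= ell3 w & ell4 w <= ell4 v].
Proof.
case/bigrassmannian_triple => a' [b' [c' Tv]] /bigrassmannian_triple [a [b [c Tw]]].
have [-> -> -> ->] := ell_triple Tv; have [-> -> -> ->] := ell_triple Tw.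
case/is_tripleP: (Tv) => ab' bc' cn' _; case/is_tripleP: (Tw) => ab bc cn _.
apply/idP/and4P => [/(bruhat_le_triple Tw Tv) [] | []] *; first by split; lia.
by apply: (triple_bruhat_le Tw Tv); lia.
Qed.

Lemma ell_inj (n : nat) (v w : 'S_n) : bigrassmannian v -> bigrassmannian w ->
  ell1 v = ell1 w -> ell2 v = ell2 w -> ell3 v = ell3 w -> v = w.
Proof.
case/bigrassmannian_triple => a' [b' [c' Tv]] /bigrassmannian_triple [a [b [c Tw]]].
have [-> -> -> _] := ell_triple Tv; have [-> -> -> _] := ell_triple Tw.
case/is_tripleP: (Tv) => ab' bc' cn' _; case/is_tripleP: (Tw) => ab bc cn _ e1 e2 e3.
have [Ea Eb Ec] : [/\ a' = a, b' = b & c' = c] by split; lia.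
by subst; apply: is_triple_inj Tv Tw.
Qed.

(** The starting value [F i0] is itself among the values, so the iterated minimum is the true
    one. *)
Lemma leq_bigminP (r : nat) (F : 'I_r -> nat) (i0 : 'I_r) (m : nat) :
  reflect (forall i, m <= F i) (m <= \big[minn/F i0]_(i < r) F i).
Proof.
apply: (iffP idP) => [le i | le].
  apply: leq_trans le _; have := mem_index_enum i; elim: (index_enum _) => // k e IH.
  by rewrite inE big_cons geq_min => /orP[/eqP-> | /IH->]; rewrite ?leqnn ?orbT.
by elim/big_rec: _ => // i x _; rewrite leq_min le.
Qed.

Theorem theorem3p8 (n r : nat) (hn : 1 <= n) (hr : 1 <= r)
    (p : 'I_r -> 'S_n) (hp : forall j : 'I_r, bigrassmannian (p j))
    (s : 'S_n) (hs : bigrassmannian s) :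
  let max1 := \max_(j < r) ell1 (p j) in
  let min2 := \big[minn/ell2 (p (Ordinal hr))]_(j < r) ell2 (p j) in
  let min3 := \big[minn/ell3 (p (Ordinal hr))]_(j < r) ell3 (p j) in
  let max4 := \max_(j < r) ell4 (p j) in
  maximal_below p s <->
  [/\ ell1 s >= max1, ell2 s <= min2, ell3 s <= min3 & ell4 s >= max4] /\
  ((ell2 s = min2 /\ ell3 s = min3) \/ (ell1 s = max1 /\ ell4 s = max4)).
Proof.
move=> max1 min2 min3 max4.
have belowP (t : 'S_n) : bigrassmannian t -> (forall j, bruhat_le t (p j)) <->
    [/\ max1 <= ell1 t, ell2 t <= min2, ell3 t <= min3 & max4 <= ell4 t].
  move=> ht; split=> [le | [le1 le2 le3 le4] j].
    have {}le j := and4P (etrans (esym (bruhat_le_ell ht (hp j))) (le j)).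
    split; [apply/bigmax_leqP | apply/(leq_bigminP (fun j => ell2 (p j)))
      | apply/(leq_bigminP (fun j => ell3 (p j))) | apply/bigmax_leqP] => j; by case: (le j).
  rewrite bruhat_le_ell //; apply/and4P; split.
  - by apply: leq_trans le1; apply: leq_bigmax.
  - by move/(leq_bigminP (fun j => ell2 (p j)) (Ordinal hr)): le2.
  - by move/(leq_bigminP (fun j => ell3 (p j)) (Ordinal hr)): le3.
  - by apply: leq_trans le4; apply: leq_bigmax.
have [s1 s2 s3 s4 s_sum] := ell_sum hs.
have [p1 _ _ p4 _] := ell_sum (hp (Ordinal hr)).
(* Positivity of the maxima keeps the outer lengths of the later witness positive. *)
have max1_gt0 : 0 < max1 by apply: leq_trans p1 _; apply: leq_bigmax.
have max4_gt0 : 0 < max4 by apply: leq_trans p4 _; apply: leq_bigmax.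
clearbody max1 min2 min3 max4.
split=> [[_ /(belowP s hs) le maxs] | [le eqs]]; last first.
  split=> // [|t ht /(belowP t ht) le_t]; first exact/(belowP s hs).
  rewrite bruhat_le_ell // => /and4P[st1 st2 st3 st4].
  have [_ _ _ _ t_sum] := ell_sum ht.
  case: le le_t => ? ? ? ? [? ? ? ?].
  (* Either both middle or both outer lengths of [t] are squeezed to those of [s]. The other two can
     only move in a common direction, so the constant sum fixes them. *)
  by apply: ell_inj => //; case: eqs => -[? ?]; lia.
split=> //; case: le => le1 le2 le3 le4.
case: (boolP ((ell2 s == min2) && (ell3 s == min3))) => [/andP[/eqP ? /eqP ?]|ne23]; first by left.
case: (boolP ((ell1 s == max1) && (ell4 s == max4))) => [/andP[/eqP ? /eqP ?]|ne14]; first by right.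
(* Read as 0 or 1, [x] selects which outer length to lower and [y] which middle length to raise. The
   sum is kept, so the new lengths belong to a common lower bound strictly above [s]. *)
exfalso; pose x := max1 < ell1 s; pose y := ell2 s < min2.
have [] := @ell_ex n (ell1 s - x) (ell2 s + y) (ell3 s + ~~ y) (ell4 s - ~~ x); rewrite /x /y; try lia.
move=> t [ht [t1 t2 t3 t4]].
have ts : t = s.
  apply: maxs => //; first by apply/(belowP t ht); rewrite t1 t2 t3 t4; split; lia.
  by rewrite bruhat_le_ell // t1 t2 t3 t4; apply/and4P; split; lia.
by move: t2 t3; rewrite ts; lia.
Qed.
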